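(* Consider exact TD-PMD with constant step size $\eta_k=\eta>0$, started from an arbitrary vector $V^0\in\mathbb{R}^{|\mathcal{S}|}$ and an arbitrary initial policy $\pi_0$, and let $\pi^*$ be a deterministic optimal policy. Let $$\kappa_0=\max\Big\{0,\ \frac{1}{1-\gamma}\max_{s\in\mathcal{S}}\,[V^0-\mathcal{T}^{\pi_0}V^0](s)\Big\}.$$ Then for every positive integer $T$, $$\|V^*-V^{\pi_T}\|_\infty\le \frac{1}{T+1}\left(\frac{1}{(1-\gamma)^2}+\frac{\|V^0\|_\infty+\kappa_0}{1-\gamma}+\frac{\|D^{\pi^*}_{\pi_0}\|_\infty}{\eta(1-\gamma)}\right),$$ $$\|V^*-V^{T}\|_\infty\le \frac{1}{T+1}\left(\frac{1}{(1-\gamma)^2}+\frac{\|V^0\|_\infty+\kappa_0}{1-\gamma}+\frac{\|D^{\pi^*}_{\pi_0}\|_\infty}{\eta(1-\gamma)}\right)+\gamma^T\kappa_0 .$$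
   Context: MDP: $\mathcal{S},\mathcal{A}$ are finite nonempty sets (states, actions), $P(\cdot|s,a)$ is a transition kernel, $r:\mathcal{S}\times\mathcal{A}\to[0,1]$ is the reward, $\gamma\in[0,1)$. $\Delta(X)$ is the probability simplex on $X$. A policy $\pi$ assigns $\pi(\cdot|s)\in\Delta(\mathcal{A})$ to each $s$. $V^\pi(s)=\mathbb{E}[\sum_{t\ge0}\gamma^t r(s_t,a_t)\mid s_0=s,\pi]$ with $a_t\sim\pi(\cdot|s_t)$, $s_{t+1}\sim P(\cdot|s_t,a_t)$; $V^*(s)=\max_\pi V^\pi(s)$; $\pi$ is optimal if $V^\pi=V^*$. The Bellman operator is $\mathcal{T}^\pi V(s)=\mathbb{E}_{a\sim\pi(\cdot|s),s'\sim P(\cdot|s,a)}[r(s,a)+\gamma V(s')]$. $\|\cdot\|_\infty$ is the max norm. Mirror map: $h$ is a convex function of Legendre type on $\mathbb{R}^{|\mathcal{A}|}$ with $\Delta(\mathcal{A})\subseteq\mathrm{dom}\,h$ and $\mathrm{rint}\,\mathrm{dom}\,h\cap\Delta(\mathcal{A})\ne\varnothing$. $D_h(p,p')=h(p)-h(p')-\langle\nabla h(p'),p-p'\rangle$. For policies $\pi,\pi'$ put $D^{\pi}_{\pi'}(s)=D_h(\pi(\cdot|s),\pi'(\cdot|s))$ and $\|D^\pi_{\pi'}\|_\infty=\max_s D^\pi_{\pi'}(s)$; for $p\in\Delta(\mathcal{A})$, $D^p_{\pi'}(s)=D_h(p,\pi'(\cdot|s))$. Initial policies satisfy $\pi_0(\cdot|s)\in\mathrm{rint}\,\mathrm{dom}\,h$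 for all $s$. Exact TD-PMD with step sizes $\eta_k>0$: given any $V^0\in\mathbb{R}^{|\mathcal{S}|}$ and $\pi_0$ ($V^0$ need not be $V^{\pi_0}$), for $k=0,1,2,\dots$ set $Q^k(s,a)=r(s,a)+\gamma\,\mathbb{E}_{s'\sim P(\cdot|s,a)}[V^k(s')]$; $\pi_{k+1}(\cdot|s)=\arg\max_{p\in\Delta(\mathcal{A})}\{\eta_k\langle p,Q^k(s,\cdot)\rangle-D^p_{\pi_k}(s)\}$ for every $s$; $V^{k+1}=\mathcal{T}^{\pi_{k+1}}V^k$. *)

(* Defs.v *)
From HB Require Import structures.
From mathcomp Require Import all_boot all_order all_algebra.
From mathcomp Require Import all_classical all_reals all_analysis.

Set Implicit Arguments.
Unset Strict Implicit.
Unset Printing Implicit Defensive.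

Import Order.TTheory GRing.Theory Num.Theory.
Import numFieldNormedType.Exports.

Local Open Scope classical_set_scope.
Local Open Scope ring_scope.

Definition simplex (R : realType) (n : nat) : set 'rV[R]_n :=
  [set p | (forall i, 0 <= p 0 i) /\ \sum_i p 0 i = 1].
Arguments simplex : clear implicits.

Definition dot (R : realType) (n : nat) (u v : 'rV[R]_n) : R :=
  \sum_i u 0 i * v 0 i.

Record mdp (R : realType) (S A : finType) := MDP {
  trans : S -> A -> S -> R;      (* [trans s a s'] is P(s' | s, a) *)
  trans_ge0 : forall s a s', 0 <= trans s a s';
  trans_sum1 : forall s a, \sum_s' trans s a s' = 1;
  reward : S -> A -> R;
  reward_itv : forall s a, 0 <= reward s a <= 1;
  discount : R;
  discount_itv : 0 <= discount < 1 }.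

(* R^|A| is ['rV[R]_#|A|]; the coordinate of [a : A] is [enum_rank a]. *)
Record policy (R : realType) (S A : finType) := Policy {
  policy_row :> S -> 'rV[R]_#|A|;
  policy_rowP : forall s, simplex R #|A| (policy_row s) }.

Definition prob (R : realType) (S A : finType) (pi : policy R S A)
  (s : S) (a : A) : R := pi s 0 (enum_rank a).

Definition deterministic (R : realType) (S A : finType) (pi : policy R S A) :=
  exists f : S -> A, forall s, prob pi s (f s) = 1.

(* [X t w] is the pair (s_t, a_t).  The law of the process is given by its
   finite-dimensional distributions
   1[s_0 = s] pi(a_0|s_0) prod_i P(s_{i+1}|s_i,a_i) pi(a_{i+1}|s_{i+1}). *)
Definition is_trajectory (R : realType) (S A : finType) (M : mdp R S A)
    (pi : policy R S A) (s : S) d (Omega : measurableType d)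
    (P : probability Omega R) (X : nat -> Omega -> S * A) : Prop :=
  (forall t x, measurable [set w | X t w = x]) /\
  (forall (t : nat) (x : nat -> S * A),
     P [set w | forall i, (i <= t)%N -> X i w = x i] =
     (((x 0%N).1 == s)%:R * prob pi (x 0%N).1 (x 0%N).2 *
      \prod_(i < t) (trans M (x i).1 (x i).2 (x i.+1).1 *
                     prob pi (x i.+1).1 (x i.+1).2))%:E).

(* Existence of trajectories, on [0, 1] with the uniform probability: a
   history [u] (most recent item first) is realised on a half-open interval whose
   length is its probability, these intervals being nested. *)
Section Realization.
Variables (R : realType) (X : finType) (q : seq X -> X -> R).
Hypothesis q_ge0 : forall u x, 0 <= q u x.
Hypothesis q_sum1 : forall u, \sum_x q u x = 1.
Variable x0 : X.

Fixpoint mass (u : seq X) : R :=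
  if u is x :: v then mass v * q v x else 1.

Definition cumul (v : seq X) (k : nat) : R :=
  \sum_(0 <= i < k) mass (nth x0 (enum X) i :: v).

Fixpoint left_end (u : seq X) : R :=
  if u is x :: v then left_end v + cumul v (enum_rank x) else 0.

Definition cell (u : seq X) : interval R :=
  `[left_end u, left_end u + mass u[.

Lemma mass_ge0 u : 0 <= mass u.
Proof. by elim: u => //= x u IH; rewrite mulr_ge0. Qed.

Lemma cumulS v k : cumul v k.+1 = cumul v k + mass (nth x0 (enum X) k :: v).
Proof. by rewrite /cumul big_nat_recr. Qed.

Lemma cumul_le v : {homo cumul v : m n / (m <= n)%N >-> m <= n}.
Proof.
apply: homo_leq => // [? ? ?|k]; first exact: le_trans.
by rewrite cumulS lerDl mass_ge0.
Qed.

Lemma cumul_full v : cumul v #|X| = mass v.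
Proof.
rewrite /cumul cardE -(big_nth x0 xpredT (fun x => mass (x :: v))) big_enum /=.
by rewrite -mulr_sumr q_sum1 mulr1.
Qed.

Lemma cellE v x : cell (x :: v) =
  `[left_end v + cumul v (enum_rank x), left_end v + cumul v (enum_rank x).+1[.
Proof. by rewrite /cell cumulS nth_enum_rank addrA. Qed.

Lemma cell_sub v x w : w \in cell (x :: v) -> w \in cell v.
Proof.
rewrite cellE /cell !in_itv /= => /andP[h1 h2]; apply/andP; split.
  apply: le_trans h1; rewrite lerDl.
  by rewrite /cumul; apply: sumr_ge0 => i _; exact: mass_ge0.
by apply: lt_le_trans h2 _; rewrite lerD2l -cumul_full; apply: cumul_le.
Qed.

Lemma cell_inj v x y w : w \in cell (x :: v) -> w \in cell (y :: v) -> x = y.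
Proof.
rewrite !cellE !in_itv /= => /andP[x1 x2] /andP[y1 y2].
have H (a b : X) : left_end v + cumul v (enum_rank a) <= w ->
    w < left_end v + cumul v (enum_rank b).+1 ->
    (enum_rank a <= enum_rank b)%N.
  move=> h1 h2; rewrite leqNgt; apply/negP => ba.
  have := le_lt_trans h1 h2; rewrite ltrD2l ltNge => /negP; apply.
  exact: cumul_le.
by apply/enum_rank_inj/val_inj/eqP; rewrite eqn_leq !H.
Qed.

Lemma cell_cover v w : w \in cell v -> exists x, w \in cell (x :: v).
Proof.
rewrite {1}/cell in_itv /= -cumul_full => /andP[h1 h2].
have : exists2 k, (k < #|X|)%N &
    left_end v + cumul v k <= w < left_end v + cumul v k.+1.
  elim: #|X| h2 => [|n IH]; first by rewrite /cumul big_nil addr0 ltNge h1.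
  move=> h2; case: (ltP w (left_end v + cumul v n)) => [/IH[k kn hk]|h3].
    by exists k => //; apply: leq_trans kn _.
  by exists n => //; apply/andP.
case=> k kn hk; exists (enum_val (Ordinal kn)).
by rewrite cellE in_itv /= enum_valK.
Qed.

Definition clamp (w : R) : R := if w \in cell [::] then w else 0.

Lemma clamp_in w : clamp w \in cell [::].
Proof. by rewrite /clamp; case: ifP => // _; rewrite /cell in_itv /= add0r lexx ltr01. Qed.

Fixpoint history (n : nat) (w : R) : seq X :=
  if n is m.+1 then
    odflt x0 [pick x | w \in cell (x :: history m w)] :: history m w
  else [::].

Definition realize (t : nat) (w : R) : X := head x0 (history t.+1 (clamp w)).

Lemma size_history n w : size (history n w) = n.
Proof. by elim: n => //= n ->. Qed.

Lemma history_in n w : w \in cell [::] -> w \in cell (history n w).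
Proof.
move=> w0; elim: n => //= n IH.
case: pickP => [x //|none]; have [x] := cell_cover IH.
by rewrite (none x).
Qed.

Lemma historyP u w : w \in cell [::] ->
  (w \in cell u) = (history (size u) w == u).
Proof.
move=> w0; apply/idP/eqP => [|<-]; last exact: history_in.
elim: u => //= x u IH wu; have e := IH (cell_sub wu); rewrite e.
case: pickP => [y yu|/(_ x)]; last by rewrite wu.
by rewrite (cell_inj yu wu).
Qed.

Local Notation P01 := (uniform_prob (@ltr01 R)).

Lemma P01_cell u : P01 ([set` cell u] : set R) = (mass u)%:E.
Proof.
have sub w : w \in cell u -> 0 <= w < 1.
  have : w \in cell u -> w \in cell [::].
    by elim: u => // x u IH /cell_sub.
  by move=> H /H; rewrite /cell in_itv /= add0r.
rewrite /uniform_prob.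
rewrite (eq_integral (fun=> 1%:E)); last first.
  move=> w; rewrite inE /= => /sub /andP[h1 h2].
  by rewrite /uniform_pdf h1 (ltW h2) /= subr0 invr1.
rewrite integral_cst /=; last exact: measurable_itv.
rewrite mul1e.
transitivity ((if ((left_end u)%:E < (left_end u + mass u)%:E)%E
   then (left_end u + mass u)%:E - (left_end u)%:E else 0)%E : \bar R).
  by rewrite /cell lebesgue_measure_itv.
rewrite lte_fin ltrDl; case: ltP => [_|h].
  by rewrite -EFinB addrAC subrr add0r.
by congr (_%:E); apply/eqP; rewrite eq_le mass_ge0 h.
Qed.

Lemma measurable_history u :
  measurable [set w | history (size u) (clamp w) = u].
Proof.
rewrite (_ : [set w | _] =
  ([set` cell [::]] `&` [set` cell u]) `|`
  (~` [set` cell [::]] `&` [set w : R | history (size u) 0 = u])).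
  apply: measurableU; first by apply: measurableI; exact: measurable_itv.
  apply: measurableI; first by apply: measurableC; exact: measurable_itv.
  have [e|e] := pselect (history (size u) 0 = u).
    by rewrite (_ : [set _ | _] = setT) //; apply/seteqP; split.
  by rewrite (_ : [set _ | _] = set0) //; apply/seteqP; split.
apply/seteqP; split => w /=.
  rewrite /clamp; case: ifP => w0 e; [left|right]; split => //.
    by rewrite historyP // e.
rewrite /clamp => -[[w0 wu]|[/negP/negbTE -> //]].
by rewrite w0; apply/eqP; rewrite -historyP.
Qed.

Lemma measurable_realize t x : measurable [set w | realize t w = x].
Proof.
rewrite (_ : [set w | _] =
    \bigcup_(u in [set: t.-tuple X])
      [set w | history (size (x :: u)) (clamp w) = x :: u]).
  apply: fin_bigcup_measurable; first exact: finite_finset.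
  by move=> u _; exact: measurable_history.
apply/seteqP; split => w /=.
  rewrite /realize /= => e.
  exists (Tuple (introT eqP (size_history t (clamp w)))) => //=.
  by rewrite size_history e.
by case=> u _; rewrite /= size_tuple /realize /= => -[].
Qed.

(* [past x n] is the history x_(n-1), ..., x_0, most recent item first. *)
Fixpoint past (x : nat -> X) (n : nat) : seq X :=
  if n is m.+1 then x m :: past x m else [::].

Lemma size_past x n : size (past x n) = n.
Proof. by elim: n => //= n ->. Qed.

Lemma realizeP n (x : nat -> X) w :
  (forall i, (i < n)%N -> realize i w = x i) <->
  history n (clamp w) = past x n.
Proof.
elim: n => [|n IH]; first by split.
split=> [H|[e1 e2] i].
  have e := IH.1 (fun i Hi => H i (ltnW Hi)).
  by rewrite [past _ _]/= -e -(H n (ltnSn n)).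
rewrite ltnS leq_eqVlt => /predU1P[->|]; first by rewrite /realize /= e1.
exact: IH.2.
Qed.

Lemma P01_realize n (x : nat -> X) :
  P01 [set w | forall i, (i < n)%N -> realize i w = x i] =
  (\prod_(i < n) q (past x i) (x i))%:E.
Proof.
set E := [set w | _].
have EE : E = [set w | history (size (past x n)) (clamp w) = past x n].
  by apply/seteqP; split => w /=; rewrite size_past => /realizeP.
have mE : measurable E by rewrite EE; exact: measurable_history.
pose I := [set` cell [::]] : set R.
have mI : measurable I by exact: measurable_itv.
have PI : P01 I = 1%E by rewrite P01_cell.
have PN : P01 (E `&` ~` I) = 0%E.
  apply/eqP; rewrite eq_le measure_ge0 andbT.
  apply: (@le_trans _ _ (P01 (~` I))).
    apply: le_measure; rewrite ?inE; last exact: subIsetr.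
      by apply: measurableI => //; exact: measurableC.
    exact: measurableC.
  have h := probability_setC P01 mI.
  by rewrite [X in (X <= _)%E]h [X in (1 - X)%E]PI subee.
have -> : E = (E `&` I) `|` (E `&` ~` I) by rewrite -setIUr setUCr setIT.
rewrite measureU //; last 3 first.
- exact: measurableI.
- by apply: measurableI => //; exact: measurableC.
- by rewrite setIACA setICr setI0.
transitivity (P01 (E `&` I)); first by rewrite [X in (_ + X)%E]PN adde0.
have -> : E `&` I = [set` cell (past x n)].
  rewrite EE; apply/seteqP; split => w /=.
    by rewrite /I /= /clamp => -[e w0]; rewrite w0 in e; rewrite historyP // e.
  move=> wu; have w0 : w \in cell [::].
    by elim: (past x n) wu => // y u IHu /cell_sub.
  by split=> //; rewrite /clamp w0; apply/eqP; rewrite -historyP.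
rewrite P01_cell; congr (_%:E).
by elim: n {E EE mE PN} => [|n IH] /=; rewrite ?big_ord0 // big_ord_recr /= IH.
Qed.

End Realization.

Lemma prob_ge0 (R : realType) (S A : finType) (pi : policy R S A) s a :
  0 <= prob pi s a.
Proof. exact: (policy_rowP pi s).1. Qed.

Lemma prob_sum1 (R : realType) (S A : finType) (pi : policy R S A) s :
  \sum_a prob pi s a = 1.
Proof.
rewrite -(policy_rowP pi s).2 (reindex (@enum_rank A)) //=.
by exists enum_val => i _; rewrite (enum_rankK, enum_valK).
Qed.

Lemma trajectory_exists (R : realType) (S A : finType) (M : mdp R S A)
    (pi : policy R S A) (s : S) :
  exists X : nat -> R -> S * A,
    is_trajectory M pi s (uniform_prob (@ltr01 R)) X.
Proof.
pose q (u : seq (S * A)) (x : S * A) : R :=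
  (if u is y :: _ then trans M y.1 y.2 x.1 else (x.1 == s)%:R) * prob pi x.1 x.2.
have q_ge0 u x : 0 <= q u x.
  by rewrite mulr_ge0 ?prob_ge0 //; case: u => *; rewrite ?ler0n ?trans_ge0.
have q_sum1 u : \sum_x q u x = 1.
  rewrite -(pair_bigA _ (fun s' a => q u (s', a))) /=.
  under eq_bigr do rewrite /q /= -mulr_sumr prob_sum1 mulr1.
  case: u => [|y u]; last exact: trans_sum1.
  rewrite (bigD1 s) //= eqxx big1 ?addr0 // => s' /negbTE -> //.
have [a _] : exists a : A, true.
  case: (pickP (@predT A)) => [a _|A0]; first by exists a.
  have := prob_sum1 pi s; rewrite big1 => [/eqP|a]; last by have := A0 a.
  by rewrite eq_sym oner_eq0.
exists (realize q (s, a)); split=> [t x|t x]; first exact: measurable_realize.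
have := P01_realize q_ge0 q_sum1 (s, a) t.+1 x.
rewrite big_ord_recl /= => ->; congr (_%:E).
Qed.

Definition discounted_return (R : realType) (S A : finType) (M : mdp R S A)
    (x : nat -> S * A) : R :=
  limn (series (fun t => discount M ^+ t * reward M (x t).1 (x t).2)).

(* [value] depends only on the law of the process, not on the realisation that
   [cid] picks. *)
Definition trajectory (R : realType) (S A : finType) (M : mdp R S A)
    (pi : policy R S A) (s : S) : nat -> R -> S * A :=
  projT1 (cid (trajectory_exists M pi s)).

Definition value (R : realType) (S A : finType) (M : mdp R S A)
    (pi : policy R S A) (s : S) : R :=
  fine ('E_(uniform_prob (@ltr01 R))
    [fun w => discounted_return M (fun t => trajectory M pi s t w)])%E.

Definition opt_value (R : realType) (S A : finType) (M : mdp R S A) (s : S) : R :=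
  sup (range (fun pi : policy R S A => value M pi s)).

Definition optimal (R : realType) (S A : finType) (M : mdp R S A)
    (pi : policy R S A) : Prop :=
  forall s, value M pi s = opt_value M s.

Definition bellman (R : realType) (S A : finType) (M : mdp R S A)
    (pi : policy R S A) (V : S -> R) (s : S) : R :=
  \sum_a prob pi s a *
    \sum_s' trans M s a s' * (reward M s a + discount M * V s').

(* The range is finite, so this is the maximum of [f] as soon as [S] is nonempty. *)
Definition maxf (R : realType) (S : finType) (f : S -> R) : R := sup (range f).

Definition norm_inf (R : realType) (S : finType) (f : S -> R) : R :=
  maxf (fun s => `|f s|).

Section Mirror.
Variables (R : realType) (n : nat).
Implicit Types (h : 'rV[R]_n -> \bar R) (p : 'rV[R]_n).

Definition dom h : set 'rV[R]_n := [set p | (h p < +oo)%E].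

Definition affine_set (C : set 'rV[R]_n) : Prop :=
  forall x y (t : R), C x -> C y -> C (t *: x + (1 - t) *: y).

Definition aff (C : set 'rV[R]_n) : set 'rV[R]_n := smallest affine_set C.

Definition rint (C : set 'rV[R]_n) : set 'rV[R]_n :=
  [set x | C x /\ \forall y \near x, aff C y -> C y].

Definition grad h p : 'rV[R]_n :=
  \row_i 'D_(delta_mx 0 i) (fine \o h) p.

Definition proper h : Prop :=
  (forall p, h p != -oo%E) /\ (exists p, dom h p).

Definition convex_efun h : Prop :=
  forall p p' (t : R), 0 < t < 1 ->
    (h (t *: p + (1 - t) *: p')%R <= t%:E * h p + (1 - t)%:E * h p')%E.

Definition strictly_convex_on (C : set 'rV[R]_n) h : Prop :=
  forall p p' (t : R), C p -> C p' -> p != p' -> 0 < t < 1 ->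
    (h (t *: p + (1 - t) *: p')%R < t%:E * h p + (1 - t)%:E * h p')%E.

(* Rockafellar's definition (Convex Analysis, section 26), which does not ask
   [h] to be lower semicontinuous on the boundary of its domain. *)
Definition legendre h : Prop :=
  let C := (dom h)° in
  [/\ proper h /\ convex_efun h,
      C !=set0,
      forall p, C p -> differentiable (fine \o h) p,
      strictly_convex_on C h &
      forall (u : nat -> 'rV[R]_n) p, (forall k, C (u k)) ->
        u k @[k --> \oo] --> p -> (closure C `\` C) p ->
        `|grad h (u k)| @[k --> \oo] --> +oo ].

Definition mirror_map h : Prop :=
  [/\ legendre h, simplex R n `<=` dom h & rint (dom h) `&` simplex R n !=set0].

Definition bregman h p p' : R :=
  fine (h p) - fine (h p') - dot (grad h p') (p - p').

End Mirror.

(* Being a maximiser; the maximiser is unique in the mirror descent step below by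
   strict convexity of the mirror map. *)
Definition is_argmax (T : Type) (R : realType) (D : set T) (F : T -> R) (x : T) :=
  D x /\ forall y, D y -> F y <= F x.

Definition qvalue (R : realType) (S A : finType) (M : mdp R S A)
    (V : S -> R) (s : S) (a : A) : R :=
  reward M s a + discount M * \sum_s' trans M s a s' * V s'.

Definition qrow (R : realType) (S A : finType) (M : mdp R S A)
    (V : S -> R) (s : S) : 'rV[R]_#|A| :=
  \row_i qvalue M V s (enum_val i).

Definition td_pmd (R : realType) (S A : finType) (M : mdp R S A)
    (h : 'rV[R]_#|A| -> \bar R) (eta : nat -> R)
    (pi : nat -> policy R S A) (V : nat -> S -> R) : Prop :=
  [/\ forall s, rint (dom h) (pi 0%N s),
      forall k s, is_argmax (simplex R #|A|)
        (fun p => eta k * dot p (qrow M (V k) s) - bregman h p (pi k s))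
        (pi k.+1 s) &
      forall k s, V k.+1 s = bellman M (pi k.+1) (V k) s ].

Definition kappa0 (R : realType) (S A : finType) (M : mdp R S A)
    (pi0 : policy R S A) (V0 : S -> R) : R :=
  Num.max 0 ((1 - discount M)^-1 * maxf (fun s => V0 s - bellman M pi0 V0 s)).

(* Main.v *)
Require Import Defs.
From HB Require Import structures.
From mathcomp Require Import all_boot all_order all_algebra.
From mathcomp Require Import all_classical all_reals all_analysis measurable_realfun.
From mathcomp Require Import ring lra.

Set Implicit Arguments.
Unset Strict Implicit.
Unset Printing Implicit Defensive.

Import Order.TTheory GRing.Theory Num.Theory.
Import numFieldNormedType.Exports.

Local Open Scope classical_set_scope.
Local Open Scope ring_scope.

(* Subtracting [gamma ^ k * kappa] from [V k] leaves the policies unchanged and gives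
   iterates [W k] the first of which lies below its own Bellman image.  Since the
   proximal step improves the Bellman image, [W k] then increases and stays below
   [value (pi k)], so both claims reduce to bounding [opt_value - W T].  The
   three-point inequality of the proximal step, taken at [pistar], bounds
   [opt_value - W (k + 1)] by
     [gamma * P_pistar (opt_value - W k) + (D k - D (k + 1)) / eta],
   where [D k] is the Bregman divergence of [pistar] from [pi k]; summing over [k]
   telescopes the divergences, and the monotonicity of [W] bounds [T + 1] times the
   last gap by the sum of the gaps. *)

(** * Maxima over a finite set and a discounted maximum principle *)

Lemma maxf_ge (R : realType) (S : finType) (f : S -> R) s : f s <= maxf f.
Proof.
apply: ub_le_sup; last by exists s.
exists (\sum_s' `|f s'|) => _ [s' _ <-].
rewrite (bigD1 s') //=; apply: (le_trans (ler_norm _)).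
by rewrite lerDl sumr_ge0.
Qed.

Lemma maxf_le (R : realType) (S : finType) (f : S -> R) c :
  (0 < #|S|)%N -> (forall s, f s <= c) -> maxf f <= c.
Proof.
move=> /card_gt0P[s _] fc; apply: ge_sup; first by exists (f s), s.
by move=> _ [s' _ <-].
Qed.

(** An average of [d] under a stochastic row is at most [maxf d], so the hypothesis taken at a
    maximiser reads [maxf d <= g * maxf d + c]. *)
Lemma discounted_max_principle (R : realType) (S : finType) (w : S -> S -> R)
    (g c : R) (d : S -> R) :
  0 <= g < 1 -> (forall s s', 0 <= w s s') -> (forall s, \sum_s' w s s' = 1) ->
  (forall s, d s <= g * (\sum_s' w s s' * d s') + c) ->
  forall s, d s <= c / (1 - g).
Proof.
move=> /andP[g0 g1] w0 w1 dle s; apply: (le_trans (maxf_ge d s)).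
have S0 : (0 < #|S|)%N by apply/card_gt0P; exists s.
have : maxf d <= g * maxf d + c.
  apply: maxf_le => // s'; apply: (le_trans (dle s')); rewrite lerD2r ler_wpM2l //.
  rewrite -[leRHS]mul1r -(w1 s') mulr_suml ler_sum // => s'' _.
  by rewrite ler_wpM2l // maxf_ge.
by rewrite ler_pdivlMr ?subr_gt0 // => ?; lra.
Qed.

(** * The Bellman operator of a policy *)

Section Bellman.
Variables (R : realType) (S A : finType) (M : mdp R S A).
Implicit Types (pi : policy R S A) (V W : S -> R).
Local Notation gamma := (discount M).

Definition policy_reward pi s := \sum_a prob pi s a * reward M s a.

Definition policy_trans pi s s' := \sum_a prob pi s a * trans M s a s'.

Lemma policy_trans_ge0 pi s s' : 0 <= policy_trans pi s s'.
Proof. by apply: sumr_ge0 => a _; rewrite mulr_ge0 ?prob_ge0 ?trans_ge0. Qed.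

Lemma policy_trans_sum1 pi s : \sum_s' policy_trans pi s s' = 1.
Proof.
rewrite exchange_big /= -(prob_sum1 pi s); apply: eq_bigr => a _.
by rewrite -mulr_sumr trans_sum1 mulr1.
Qed.

Lemma policy_reward_itv pi s : 0 <= policy_reward pi s <= 1.
Proof.
apply/andP; split.
  apply: sumr_ge0 => a _; rewrite mulr_ge0 ?prob_ge0 //.
  by have /andP[] := reward_itv M s a.
rewrite -(prob_sum1 pi s) ler_sum // => a _.
by rewrite ler_piMr ?prob_ge0 //; have /andP[] := reward_itv M s a.
Qed.

Lemma bellman_qvalue pi V s :
  bellman M pi V s = \sum_a prob pi s a * qvalue M V s a.
Proof.
apply: eq_bigr => a _; congr (_ * _); rewrite /qvalue.
under eq_bigr do rewrite mulrDr mulrCA.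
by rewrite big_split /= -mulr_suml trans_sum1 mul1r -mulr_sumr.
Qed.

Lemma bellman_dot pi V s : bellman M pi V s = dot (pi s) (qrow M V s).
Proof.
rewrite bellman_qvalue /dot (reindex (@enum_rank A)) /=; last first.
  by exists enum_val => i _; rewrite (enum_rankK, enum_valK).
by apply: eq_bigr => a _; rewrite mxE enum_rankK.
Qed.

Lemma bellmanE pi V s : bellman M pi V s =
  policy_reward pi s + gamma * \sum_s' policy_trans pi s s' * V s'.
Proof.
rewrite bellman_qvalue /policy_reward /policy_trans /qvalue.
under eq_bigr do rewrite mulrDr.
rewrite big_split /=; congr (_ + _).
under [in RHS]eq_bigr do rewrite mulr_suml.
rewrite exchange_big /= mulr_sumr; apply: eq_bigr => a _.
rewrite mulrCA; congr (_ * _); rewrite mulr_sumr.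
by apply: eq_bigr => s' _; rewrite mulrA.
Qed.

Lemma bellmanB pi V W s : bellman M pi V s - bellman M pi W s =
  gamma * \sum_s' policy_trans pi s s' * (V s' - W s').
Proof.
rewrite !bellmanE opprD addrACA subrr add0r -mulrBr -sumrB.
by under [in RHS]eq_bigr do rewrite mulrBr.
Qed.

Lemma bellman_mono pi V W s :
  (forall s', V s' <= W s') -> bellman M pi V s <= bellman M pi W s.
Proof.
move=> VW; rewrite -subr_ge0 bellmanB mulr_ge0 //.
  by have /andP[] := discount_itv M.
by apply: sumr_ge0 => s' _; rewrite mulr_ge0 ?policy_trans_ge0 ?subr_ge0.
Qed.

Lemma bellman_shift pi V c s :
  bellman M pi (fun s' => V s' - c) s = bellman M pi V s - gamma * c.
Proof.
rewrite !bellmanE -addrA -mulrBr; congr (_ + _ * _).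
under eq_bigr do rewrite mulrBr.
by rewrite sumrB -mulr_suml policy_trans_sum1 mul1r.
Qed.

(** The difference [V - W] is at most [gamma] times its own average under [policy_trans], so the
    maximum principle applies with constant 0. *)
Lemma bellman_le_fixpoint pi V W :
  (forall s, W s = bellman M pi W s) -> (forall s, V s <= bellman M pi V s) ->
  forall s, V s <= W s.
Proof.
move=> Wfix Vle s; rewrite -subr_le0 -[leRHS](mul0r (1 - gamma)^-1).
apply: (@discounted_max_principle _ _ (policy_trans pi) _ _
  (fun s => V s - W s) (discount_itv M)) => [| |s'].
- exact: policy_trans_ge0.
- exact: policy_trans_sum1.
- by rewrite addr0 -bellmanB [W s' in leLHS]Wfix lerD2r.
Qed.

End Bellman.

(** * Integration of random variables with finitely many values *)

Section FiniteValued.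
Variables (R : realType) (d : measure_display) (Omega : measurableType d).
Variables (P : probability Omega R) (X : finType) (Z : Omega -> X).
Hypothesis mZ : forall z, measurable [set w | Z w = z].

Lemma indic_levelE (g : X -> R) w :
  g (Z w) = \sum_z g z * \1_[set w' | Z w' = z] w.
Proof.
rewrite (bigD1 (Z w)) //= indicE mem_set // mulr1 big1 ?addr0 // => z zw.
by rewrite indicE memNset ?mulr0 //= => e; rewrite e eqxx in zw.
Qed.

Lemma measurable_finite_valued (g : X -> R) :
  measurable_fun [set: Omega] (fun w => g (Z w)).
Proof.
rewrite (_ : (fun w => _) =
    (fun w => \sum_z g z * \1_[set w' | Z w' = z] w)); last first.
  by apply/funext => w; exact: indic_levelE.
by apply: measurable_sum => z; apply: measurable_funM.
Qed.

Lemma integral_finite_valued (g : X -> R) : (forall z, 0 <= g z) ->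
  (\int[P]_w (g (Z w))%:E =
   \sum_z (g z)%:E * P [set w | Z w = z])%E.
Proof.
move=> g0; under eq_integral do rewrite indic_levelE -sumEFin.
rewrite ge0_integral_sum //=; last 2 first.
- move=> z; apply/measurable_EFinP; exact: measurable_funM.
- by move=> z w _; rewrite lee_fin mulr_ge0.
apply: eq_bigr => z _; under eq_integral do rewrite EFinM.
rewrite ge0_integralZl_EFin //=; first by rewrite integral_indic ?setIT.
exact/measurable_EFinP.
Qed.

(** The indicator of [E] is the sum of its restrictions to the level sets of [Z]; integrating this
    identity gives the claim. *)
Lemma measure_level_partition E : measurable E ->
  P E = (\sum_z P (E `&` [set w | Z w = z]))%E.
Proof.
move=> mE; rewrite -[E in LHS]setIT -integral_indic //.
transitivity (\int[P]_w (\sum_z (\1_(E `&` [set w' | Z w' = z]) w)%:E))%E.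
  apply: eq_integral => w _; rewrite sumEFin; congr (_%:E).
  under [RHS]eq_bigr do rewrite indicI /=.
  by rewrite -(indic_levelE (fun=> \1_E w)).
rewrite ge0_integral_sum //=; last first.
  by move=> z; apply/measurable_EFinP/measurable_indic; exact: measurableI.
by apply: eq_bigr => z _; rewrite integral_indic ?setIT //; exact: measurableI.
Qed.

End FiniteValued.

(** * Marginal laws of the state-action chain *)

Section Law.
Variables (R : realType) (S A : finType) (M : mdp R S A) (pi : policy R S A).
Local Notation gamma := (discount M).

Definition step (x y : S * A) : R := trans M x.1 x.2 y.1 * prob pi y.1 y.2.

(** The forward recursion for the marginal at time [t] of the Markov chain with kernel [step];
    [trajectory_law] shows that every trajectory has these marginals. *)
Fixpoint law (s : S) (t : nat) (y : S * A) : R :=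
  if t is u.+1 then \sum_x law s u x * step x y
  else (y.1 == s)%:R * prob pi y.1 y.2.

Lemma step_ge0 x y : 0 <= step x y.
Proof. by rewrite mulr_ge0 ?trans_ge0 ?prob_ge0. Qed.

Lemma sum_pair_prob (f : S -> R) (g : S -> A -> R) :
  \sum_y f y.1 * prob pi y.1 y.2 * g y.1 y.2 =
  \sum_s f s * \sum_a prob pi s a * g s a.
Proof.
rewrite -(pair_bigA _ (fun s a => f s * prob pi s a * g s a)) /=.
apply: eq_bigr => s _; rewrite mulr_sumr; apply: eq_bigr => a _.
by rewrite mulrA.
Qed.

Lemma law_ge0 s t y : 0 <= law s t y.
Proof.
elim: t y => [|t IH] y /=; first by rewrite mulr_ge0 ?ler0n ?prob_ge0.
by apply: sumr_ge0 => x _; rewrite mulr_ge0 ?step_ge0.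
Qed.

Lemma law_sum1 s t : \sum_y law s t y = 1.
Proof.
elim: t => [|t IH] /=.
  under eq_bigr do rewrite -[_ * _]mulr1.
  rewrite (sum_pair_prob (fun s' => (s' == s)%:R) (fun _ _ => 1)).
  under eq_bigr do (under eq_bigr do rewrite mulr1).
  under eq_bigr do rewrite prob_sum1 mulr1.
  by rewrite (bigD1 s) //= eqxx big1 ?addr0 // => s' /negbTE ->.
rewrite exchange_big /= -[RHS]IH; apply: eq_bigr => x _.
rewrite -mulr_sumr /step; under eq_bigr do rewrite -[_ * _]mulr1.
rewrite (sum_pair_prob (trans M x.1 x.2) (fun _ _ => 1)).
under eq_bigr do (under eq_bigr do rewrite mulr1).
under eq_bigr do rewrite prob_sum1 mulr1.
by rewrite trans_sum1 mulr1.
Qed.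

(* Conditioning on the first transition instead of the last. *)
Lemma law_first s t y :
  law s t.+1 y = \sum_s' policy_trans M pi s s' * law s' t y.
Proof.
elim: t y => [|t IH] y.
  transitivity (\sum_a prob pi s a * step (s, a) y).
    transitivity (\sum_x (x.1 == s)%:R * prob pi x.1 x.2 * step (x.1, x.2) y).
      by apply: eq_bigr => -[].
    rewrite (sum_pair_prob (fun s' => (s' == s)%:R) (fun s a => step (s, a) y)).
    rewrite (bigD1 s) //= eqxx mul1r.
    by rewrite [X in _ + X]big1 ?addr0 // => s' /negbTE ->; rewrite mul0r.
  rewrite [RHS](bigD1 y.1) //= [X in _ + X]big1 ?addr0; last first.
    by move=> s' ys; rewrite eq_sym (negbTE ys) mul0r mulr0.
  rewrite eqxx mul1r /policy_trans mulr_suml; apply: eq_bigr => a _.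
  by rewrite /step mulrA.
rewrite -[LHS]/(\sum_x law s t.+1 x * step x y).
under eq_bigr do rewrite IH mulr_suml.
rewrite exchange_big /=; apply: eq_bigr => s' _.
by rewrite mulr_sumr; apply: eq_bigr => x _; rewrite mulrA.
Qed.

Definition mean_reward s t : R := \sum_x law s t x * reward M x.1 x.2.

Lemma mean_reward0 s : mean_reward s 0 = policy_reward M pi s.
Proof.
rewrite /mean_reward /= (sum_pair_prob (fun s' => (s' == s)%:R)) (bigD1 s) //=.
by rewrite eqxx mul1r [X in _ + X]big1 ?addr0 // => s' /negbTE ->; rewrite mul0r.
Qed.

Lemma mean_rewardS s t :
  mean_reward s t.+1 = \sum_s' policy_trans M pi s s' * mean_reward s' t.
Proof.
rewrite /mean_reward; under eq_bigr do rewrite law_first mulr_suml.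
rewrite exchange_big /=; apply: eq_bigr => s' _.
by rewrite mulr_sumr; apply: eq_bigr => x _; rewrite mulrA.
Qed.

Lemma mean_reward_itv s t : 0 <= mean_reward s t <= 1.
Proof.
apply/andP; split.
  apply: sumr_ge0 => x _; rewrite mulr_ge0 ?law_ge0 //.
  by have /andP[] := reward_itv M x.1 x.2.
rewrite -(law_sum1 s t) ler_sum // => x _.
by rewrite ler_piMr ?law_ge0 //; have /andP[] := reward_itv M x.1 x.2.
Qed.

Lemma trajectory_law s (d : measure_display) (Omega : measurableType d)
    (P : probability Omega R) (X : nat -> Omega -> S * A) :
  is_trajectory M pi s P X ->
  forall t x, P [set w | X t w = x] = (law s t x)%:E.
Proof.
move=> [mX PX].
(* Marginalises the finite-dimensional laws by summing out the earliest time. *)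
have window k t (x : nat -> S * A) : (k <= t)%N ->
    P [set w | forall i, (k <= i <= t)%N -> X i w = x i] =
    (law s k (x k) * \prod_(k <= i < t) step (x i) (x i.+1))%:E.
  elim: k x => [|k IH] x kt.
    by rewrite PX /= big_mkord.
  have mE : measurable [set w | forall i, (k.+1 <= i <= t)%N -> X i w = x i].
    rewrite (_ : [set w | _] =
        \bigcap_(i in [set i | (k.+1 <= i <= t)%N]) [set w | X i w = x i]) //.
    by exact: bigcap_measurableType.
  rewrite (measure_level_partition P (mX k) mE) /= mulr_suml -sumEFin.
  apply: eq_bigr => z _.
  (* Prescribing [z] at time [k] turns each piece of the partition into a window starting at [k],
     where the induction hypothesis applies; the sum over [z] then rebuilds [law] at [k.+1]. *)
  pose x' i := if i == k then z else x i.
  rewrite [X in P X](_ : _ =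
      [set w | forall i, (k <= i <= t)%N -> X i w = x' i]); last first.
    apply/seteqP; split => w /= => [[H e] i /andP[ki it]|H].
      rewrite /x'; case: eqP => [->//|/eqP ik].
      by apply: H; rewrite ltn_neqAle eq_sym ik ki.
    split=> [i /andP[ki it]|].
      by rewrite H ?it ?(ltnW ki) // /x' gtn_eqF.
    by rewrite H ?leqnn ?(ltnW kt) // /x' eqxx.
  rewrite IH ?(ltnW kt) // [in LHS]big_ltn // mulrA /x' eqxx gtn_eqF //.
  congr (_ * _)%:E; apply: eq_big_nat => i /andP[ki _].
  by rewrite !gtn_eqF // ltnW.
move=> t x; have := window t t (fun=> x) (leqnn t).
rewrite big_geq // mulr1 => <-; congr (P _); apply/seteqP; split => w /=.
  by move=> e i; rewrite -eqn_leq => /eqP <-.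
by apply; rewrite leqnn.
Qed.

Definition partial_value (n : nat) (s : S) : R :=
  \sum_(0 <= t < n) gamma ^+ t * mean_reward s t.

(** The first reward splits off, and the remaining ones are conditioned on the first transition by
    [mean_rewardS]: truncated values are value iteration from 0. *)
Lemma partial_valueS n s :
  partial_value n.+1 s = bellman M pi (partial_value n) s.
Proof.
rewrite bellmanE /partial_value big_nat_recl // expr0 mul1r mean_reward0.
congr (_ + _); under [in RHS]eq_bigr do rewrite mulr_sumr.
rewrite exchange_big /= mulr_sumr; apply: eq_bigr => t _.
rewrite mean_rewardS exprS -mulrA !mulr_sumr; apply: eq_bigr => s' _.
by rewrite [gamma ^+ t * _]mulrCA.
Qed.

End Law.

(** * The value as a limit and as a fixed point of the Bellman operator *)

Section DiscountedReturn.
Variables (R : realType) (S A : finType) (M : mdp R S A) (pi : policy R S A).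
Local Notation gamma := (discount M).

Lemma is_cvg_discounted (u : nat -> R) : (forall t, 0 <= u t <= 1) ->
  cvgn (series (fun t => gamma ^+ t * u t)).
Proof.
move=> u01; have /andP[g0 g1] := discount_itv M.
apply: (@series_le_cvg _ _ (geometric 1 gamma)) => [t|t|t|].
- by have /andP[u0 _] := u01 t; rewrite mulr_ge0 ?exprn_ge0.
- by rewrite /geometric /= mul1r exprn_ge0.
- have /andP[_ u1] := u01 t.
  by rewrite /geometric /= mul1r ler_piMr ?exprn_ge0.
- by apply: is_cvg_geometric_series; rewrite ger0_norm.
Qed.

Lemma partial_value_cvg s :
  partial_value M pi n s @[n --> \oo] --> value M pi s.
Proof.
have /andP[g0 g1] := discount_itv M.
have cv : cvgn (series (fun t => gamma ^+ t * mean_reward M pi s t)).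
  by apply: is_cvg_discounted => t; exact: mean_reward_itv.
suff -> : value M pi s =
  limn (series (fun t => gamma ^+ t * mean_reward M pi s t)) by [].
rewrite /value unlock /=.
have traj : is_trajectory M pi s (uniform_prob (@ltr01 R)) (trajectory M pi s).
  by rewrite /trajectory; case: cid.
have mX := traj.1.
set P := uniform_prob _ in traj *; set X := trajectory M pi s in traj mX *.
have rew0 t z : 0 <= gamma ^+ t * reward M z.1 z.2.
  by rewrite mulr_ge0 ?exprn_ge0 //; have /andP[] := reward_itv M z.1 z.2.
transitivity (fine (\int[P]_w
    (\sum_(t <oo) (gamma ^+ t * reward M (X t w).1 (X t w).2)%:E)))%E.
  congr fine; apply: eq_integral => w _.
  rewrite /discounted_return -EFin_lim; last first.
    by apply: is_cvg_discounted => t; exact: reward_itv.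
  by congr (lim (_ @ \oo)); apply/funext => n /=; rewrite sumEFin.
(* Rewards are nonnegative, so expectation and series may be exchanged; each term then depends only
   on the marginal law at time [t]. *)
rewrite integral_nneseries //; last 2 first.
- move=> t; apply/measurable_EFinP.
  exact: (measurable_finite_valued (mX t) (fun z => gamma ^+ t * reward M z.1 z.2)).
- by move=> t w _; rewrite lee_fin.
transitivity (fine (\sum_(t <oo) (gamma ^+ t * mean_reward M pi s t)%:E))%E.
  congr fine; apply: eq_eseriesr => t _.
  rewrite (integral_finite_valued P (mX t) (rew0 t)).
  rewrite /mean_reward mulr_sumr -sumEFin; apply: eq_bigr => z _.
  by rewrite (trajectory_law traj) -EFinM -mulrA [law _ _ _ _ _ * _]mulrC.
rewrite (_ : (\sum_(t <oo) _)%E =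
  limn (EFin \o series (fun t => gamma ^+ t * mean_reward M pi s t))).
  by rewrite EFin_lim.
by congr (lim (_ @ \oo)); apply/funext => n /=; rewrite sumEFin.
Qed.

(** Both sides are limits of [partial_value M pi n.+1 s], the right one because the Bellman operator
    is a finite affine expression in its argument. *)
Lemma value_bellman s : value M pi s = bellman M pi (value M pi) s.
Proof.
have lim1 : partial_value M pi n.+1 s @[n --> \oo] --> value M pi s.
  by have := @partial_value_cvg s; rewrite -cvg_shiftS.
have lim2 : partial_value M pi n.+1 s @[n --> \oo] --> bellman M pi (value M pi) s.
  rewrite (_ : (fun n => _) = (fun n => policy_reward M pi s +
    gamma * \sum_s' policy_trans M pi s s' * partial_value M pi n s')); last first.
    by apply/funext => n; rewrite partial_valueS bellmanE.
  rewrite bellmanE; apply: cvgD; first exact: cvg_cst.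
  apply: cvgM; first exact: cvg_cst.
  apply: cvg_big => [|s' _]; first exact: add_continuous.
  by apply: cvgM; [exact: cvg_cst|exact: partial_value_cvg].
exact: (cvg_unique _ lim1 lim2).
Qed.

Lemma value_itv s : 0 <= value M pi s <= (1 - gamma)^-1.
Proof.
have /andP[g0 g1] := discount_itv M.
apply/andP; split.
  apply: (@bellman_le_fixpoint _ _ _ M pi (fun=> 0) _ value_bellman) => s'.
  rewrite bellmanE big1 ?mulr0 ?addr0 => [|? _]; last by rewrite mulr0.
  by have /andP[] := policy_reward_itv M pi s'.
rewrite -[leRHS]mul1r; move: s.
apply: (@discounted_max_principle _ _ (policy_trans M pi)).
- exact: discount_itv.
- exact: policy_trans_ge0.
- exact: policy_trans_sum1.
- move=> s; rewrite [leLHS]value_bellman bellmanE addrC lerD2l.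
  by have /andP[] := policy_reward_itv M pi s.
Qed.

End DiscountedReturn.

(** A real supremum is an upper bound only for a bounded set; the bound [(1 - discount M)^-1] comes
    from [value_itv]. *)
Lemma value_le_opt (R : realType) (S A : finType) (M : mdp R S A)
  (pi : policy R S A) s : value M pi s <= opt_value M s.
Proof.
apply: ub_le_sup; last by exists pi.
by exists (1 - discount M)^-1 => _ [pi' _ <-]; have /andP[] := value_itv M pi' s.
Qed.

(** * The scalar product, the simplex and the max norm *)

Section Dot.
Variables (R : realType) (n : nat).
Implicit Types u v w : 'rV[R]_n.

Lemma dotDl u v w : dot (u + v) w = dot u w + dot v w.
Proof. by rewrite /dot -big_split; apply: eq_bigr => i _; rewrite mxE mulrDl. Qed.

Lemma dotDr u v w : dot w (u + v) = dot w u + dot w v.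
Proof. by rewrite /dot -big_split; apply: eq_bigr => i _; rewrite mxE mulrDr. Qed.

Lemma dotZl t u v : dot (t *: u) v = t * dot u v.
Proof. by rewrite /dot mulr_sumr; apply: eq_bigr => i _; rewrite mxE mulrA. Qed.

Lemma dotZr t u v : dot u (t *: v) = t * dot u v.
Proof. by rewrite /dot mulr_sumr; apply: eq_bigr => i _; rewrite mxE mulrCA. Qed.

Lemma dotBr u v w : dot w (u - v) = dot w u - dot w v.
Proof. by rewrite dotDr -scaleN1r dotZr mulN1r. Qed.

Lemma dotC u v : dot u v = dot v u.
Proof. by apply: eq_bigr => i _; rewrite mulrC. Qed.

Lemma dot_delta u i : dot u (delta_mx 0 i) = u 0 i.
Proof.
rewrite /dot (bigD1 i) //= mxE !eqxx mulr1 big1 ?addr0 // => j /negbTE ji.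
by rewrite mxE ji andbF mulr0.
Qed.

Lemma simplex_convex p q (t : R) : simplex R n p -> simplex R n q ->
  0 <= t <= 1 -> simplex R n (p + t *: (q - p)).
Proof.
move=> [p0 p1] [q0 q1] /andP[t0 t1]; split => [i|].
  rewrite !mxE (_ : _ + _ = (1 - t) * p 0 i + t * q 0 i); last by ring.
  by rewrite addr_ge0 ?mulr_ge0 ?subr_ge0.
under eq_bigr do rewrite !mxE mulrBr.
rewrite big_split /= sumrB -!mulr_sumr p1 q1; ring.
Qed.

Lemma mx_norm_le_coord u (K : 'I_n -> R) :
  (forall i, `|u 0 i| <= K i) -> `|u| <= \sum_i `|K i|.
Proof.
move=> uK; rewrite -[leLHS]/(mx_norm u) mx_normrE.
apply: bigmax_le => [|[i j] _ /=]; first exact: sumr_ge0.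
rewrite [i]ord1 (le_trans (uK j)) // (bigD1 j) //=.
by rewrite (le_trans (ler_norm _)) // lerDl sumr_ge0.
Qed.

End Dot.

(** * Convex functions of Legendre type *)

Section ConvexAnalysis.
Variables (R : realType) (n : nat) (h : 'rV[R]_n -> \bar R).
Local Notation f := (fine \o h).
Local Notation C := ((dom h)°).

Lemma cvg_line (a v : 'rV[R]_n) : (a + t *: v) @[t --> (0 : R)] --> a.
Proof.
rewrite -[X in _ --> X]addr0 -[X in _ + X](scale0r v).
by apply: cvgD; [exact: cvg_cst|apply: cvgZ; [exact: cvg_id|exact: cvg_cst]].
Qed.

Lemma dilation_continuous (p : 'rV[R]_n) (s : R) :
  continuous (fun y : 'rV[R]_n => p + s *: (y - p)).
Proof.
move=> y.
apply: (@cvgD _ _ _ (nbhs y) _ (cst p) (fun y : 'rV[R]_n => s *: (y - p))).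
  exact: cvg_cst.
apply: (@cvgZ _ _ _ (nbhs y) _ (cst s) (fun y : 'rV[R]_n => y - p)).
  exact: cvg_cst.
apply: (@cvgB _ _ _ (nbhs y) _ id (cst p)); first exact: cvg_id.
exact: cvg_cst.
Qed.

Section Gradient.
Variables (p : 'rV[R]_n).
Hypothesis diffp : differentiable f p.

Lemma dot_grad v : dot (grad h p) v = 'D_v f p.
Proof.
rewrite deriveE // [in RHS](row_sum_delta v) linear_sum /dot.
by apply: eq_bigr => i _; rewrite mxE deriveE // linearZ /= mulrC.
Qed.

(** The quotient is taken from the right because convexity and minimality control [f] only along
    segments, for [0 < t < 1]. *)
Lemma grad_cvg_right v :
  (t^-1 * (f (p + t *: v) - f p)) @[t --> 0^'+] --> dot (grad h p) v.
Proof.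
rewrite dot_grad; apply: cvg_dnbhs_at_right.
have := @diff_derivable _ _ _ f p v diffp; rewrite /derivable /derive /=.
rewrite (_ : (fun t => t^-1 *: _) = (fun t => t^-1 * (f (p + t *: v) - f p))) //.
by apply/funext => t; rewrite [p + _]addrC.
Qed.

Lemma dot_grad_le v k :
  (forall t, 0 < t < 1 -> f (p + t *: v) - f p <= t * k) ->
  dot (grad h p) v <= k.
Proof.
move=> H; apply: (cvgr_to_le (@grad_cvg_right v)); near=> t.
have t0 : 0 < t by near: t; exact: nbhs_right_gt.
rewrite mulrC ler_pdivrMr // mulrC H // t0 /=.
by near: t; exact: nbhs_right_lt.
Unshelve. all: by end_near. Qed.

Lemma dot_grad_ge v k :
  (forall t, 0 < t < 1 -> t * k <= f (p + t *: v) - f p) ->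
  k <= dot (grad h p) v.
Proof.
move=> H; apply: (cvgr_to_ge (@grad_cvg_right v)); near=> t.
have t0 : 0 < t by near: t; exact: nbhs_right_gt.
rewrite mulrC ler_pdivlMr // mulrC H // t0 /=.
by near: t; exact: nbhs_right_lt.
Unshelve. all: by end_near. Qed.

End Gradient.

Hypothesis proper_h : Defs.proper h.
Hypothesis convex_h : convex_efun h.

Lemma fine_dom p : dom h p -> h p = (f p)%:E.
Proof.
move=> hp; rewrite /= fineK // fin_numE (proper_h.1 p) /=.
by rewrite -ltey; exact: hp.
Qed.

Lemma convex_fine p q t : dom h p -> dom h q -> 0 < t < 1 ->
  dom h (p + t *: (q - p)) /\ f (p + t *: (q - p)) <= (1 - t) * f p + t * f q.
Proof.
move=> hp hq t01.
have := @convex_h q p t t01.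
rewrite (_ : t *: q + (1 - t) *: p = p + t *: (q - p)); last first.
  by rewrite scalerBl scale1r scalerBr addrCA.
rewrite (fine_dom hp) (fine_dom hq) -!EFinM -EFinD => le.
have hr : dom h (p + t *: (q - p)) by exact: le_lt_trans le (ltry _).
split => //; move: le.
by rewrite (fine_dom hr) lee_fin [(1 - t) * _ + _]addrC.
Qed.

Lemma interior_dom p : C p -> dom h p.
Proof. exact: interior_subset. Qed.

(** The dilation centred at [p] with ratio [t^-1] sends the point to [a], hence points near it into
    [dom h]; each of these is a convex combination of [p] and its image. *)
Lemma interior_segment p a t : dom h p -> C a -> 0 < t <= 1 ->
  C (p + t *: (a - p)).
Proof.
move=> hp Ca /andP[t0]; rewrite le_eqVlt => /predU1P[->|t1].
  by rewrite scale1r addrC subrK.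
set x := p + _.
have cv : (p + t^-1 *: (y - p)) @[y --> x] --> a.
  have <- : p + t^-1 *: (x - p) = a.
    by rewrite /x addrAC subrr add0r scalerA mulVf ?gt_eqF // scale1r addrC subrK.
  exact: dilation_continuous.
have : \forall y \near x, dom h (p + t^-1 *: (y - p)) by exact: cv _ Ca.
apply: filterS => y hy.
have [] := convex_fine hp hy (introT andP (conj t0 t1)).
by rewrite addrAC subrr add0r scalerA mulfV ?gt_eqF // scale1r addrC subrK.
Qed.

(** Since [dom h] has an interior point [a], its affine hull is the whole space: any [y] lies on the
    line through [a] and a point of [dom h] slightly off [a] towards [y]. *)
Lemma rint_interior p : C !=set0 -> rint (dom h) p -> C p.
Proof.
move=> [a Ca] [_]; apply: filterS => y; apply => D [affD domD].
have [t [t0 ht]] : exists t : R, 0 < t /\ dom h (a + t *: (y - a)).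
  have : \forall t \near 0^'+, dom h (a + t *: (y - a)).
    by apply: cvg_within; exact: (@cvg_line a (y - a) _ Ca).
  move=> H; near (0 : R)^'+ => t; exists t; split; near: t => //.
  exact: nbhs_right_gt.
have <- : t^-1 *: (a + t *: (y - a)) + (1 - t^-1) *: a = y.
  by apply/rowP => i; rewrite !mxE; field; rewrite gt_eqF.
exact: affD (domD _ ht) (domD _ (interior_dom Ca)).
Unshelve. all: by end_near. Qed.

Hypothesis diff_h : forall p, C p -> differentiable f p.

(** Convexity bounds every difference quotient from [p] towards [q] by the chord slope
    [f q - f p]. *)
Lemma grad_ineq p q : C p -> dom h q -> f p + dot (grad h p) (q - p) <= f q.
Proof.
move=> Cp hq; rewrite -lerBrDl; apply: dot_grad_le; first exact: diff_h.
move=> t t01; have [_] := convex_fine (interior_dom Cp) hq t01.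
by lra.
Qed.

Lemma bregman_ge0 p q : C q -> dom h p -> 0 <= bregman h p q.
Proof. by move=> Cq hp; have := grad_ineq Cq hp; rewrite /bregman /=; lra. Qed.

Hypothesis steep_h : forall (u : nat -> 'rV[R]_n) p, (forall k, C (u k)) ->
  u k @[k --> \oo] --> p -> (closure C `\` C) p ->
  `|grad h (u k)| @[k --> \oo] --> +oo.

(* Along the segment from a boundary minimiser [p] to an interior feasible point
   [a], minimality bounds [dot (grad h x) (a - p)] from below; as [a] has room in
   every coordinate direction, the gradient inequality then bounds all of
   [grad h x], against steepness. *)
Lemma argmin_interior (D : set 'rV[R]_n) (c p a : 'rV[R]_n) :
  (forall x y (t : R), D x -> D y -> 0 <= t <= 1 -> D (x + t *: (y - x))) ->
  D `<=` dom h -> D a -> C a -> D p ->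
  (forall q, D q -> f p - dot c p <= f q - dot c q) -> C p.
Proof.
move=> convD Ddom Da Ca Dp pmin; apply: contrapT => nCp.
pose t k : R := k.+1%:R^-1.
pose u k := p + t k *: (a - p).
have t01 k : 0 < t k <= 1.
  by rewrite /t invr_gt0 ltr0n /= invf_le1 ?ltr0n // ler1n.
have hp := Ddom _ Dp.
have Cu k : C (u k) by exact: interior_segment.
have up : u k @[k --> \oo] --> p.
  apply: (cvg_comp t (fun s => p + s *: (a - p))); last exact: cvg_line.
  exact: cvg_harmonic.
have clp : (closure C `\` C) p.
  split=> // B Bp; have [k _ kB] := up _ Bp.
  by exists (u k); split => //; apply: kB => /=.
have low : `|grad h (u k)| @[k --> \oo] --> +oo := steep_h Cu up clp.
pose m := dot c (a - p).
have Du k : D (u k) by apply: convD => //; have /andP[/ltW-> ->] := t01 k.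
have fu k : f p + t k * m <= f (u k).
  have := pmin _ (Du k); rewrite /u dotDr dotZr -/m -/(u k); lra.
(* The gradient inequality at [u k] tested at [p] gives [f (u k) - f p <= t k * dot (grad h (u k))
   (a - p)], and [fu] bounds the left side below by [t k * m]. *)
have gm k : m <= dot (grad h (u k)) (a - p).
  have /andP[tk0 _] := t01 k.
  rewrite -(ler_pM2l tk0).
  have := grad_ineq (Cu k) hp.
  rewrite (_ : p - u k = - t k *: (a - p)); last first.
    by rewrite /u opprD addNKr scaleNr.
  by rewrite dotZr mulNr; have := fu k; lra.
have coord i : exists K, forall k, `|grad h (u k) 0 i| <= K.
  have [e [e0 [hpos hneg]]] : exists e : R, 0 < e /\
      (dom h (a + e *: delta_mx 0 i) /\ dom h (a + e *: - delta_mx 0 i)).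
    near (0 : R)^'+ => e; exists e; split; last split; near: e.
    - exact: nbhs_right_gt.
    - by apply: cvg_within; exact: (@cvg_line a (delta_mx 0 i) _ Ca).
    - by apply: cvg_within; exact: (@cvg_line a (- delta_mx 0 i) _ Ca).
  pose b := `|f (a + e *: delta_mx 0 i)| + `|f (a + e *: - delta_mx 0 i)|.
  exists ((b - f p + `|m|) / e) => k.
  have /andP[tk0 tk1] := t01 k.
  have dir v : dom h (a + e *: v) -> f (a + e *: v) <= b ->
      dot (grad h (u k)) v <= (b - f p + `|m|) / e.
    move=> hv fb; rewrite ler_pdivlMr //.
    have := grad_ineq (Cu k) hv.
    (* The displacement has a part along [a - p], bounded below by [gm], and the part [e *: v] to be
       estimated. With [fu], the terms [t k * m] and [(1 - t k) * m] add up to [m], so the bound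
       does not depend on [k]. *)
    rewrite (_ : _ - u k = (1 - t k) *: (a - p) + e *: v); last first.
      by apply/rowP => j; rewrite !mxE; ring.
    rewrite dotDr !dotZr.
    have : (1 - t k) * m <= (1 - t k) * dot (grad h (u k)) (a - p).
      by rewrite ler_wpM2l // subr_ge0.
    have := fu k; have := ler_norm (- m); rewrite normrN.
    by move=> *; lra.
  rewrite ler_norml -[_ 0 i]dot_delta; apply/andP; split.
    rewrite lerNl -mulN1r -dotZr scaleN1r; apply: dir => //.
    by rewrite (le_trans (ler_norm _)) // lerDr.
  by apply: dir => //; rewrite (le_trans (ler_norm _)) // lerDl.
have [K HK] := fin_all_exists coord.
have [k _ /(_ k (leqnn k))] := (cvgryPgt _).1 low (\sum_i `|K i|).
rewrite /= ltNge => /negP; apply.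
by apply: mx_norm_le_coord => i; exact: HK.
Unshelve. all: by end_near. Qed.


End ConvexAnalysis.

(** * The proximal step of mirror descent *)

Section MirrorDescent.
Variables (R : realType) (n : nat) (h : 'rV[R]_n -> \bar R).
Hypothesis mirror_h : mirror_map h.
Local Notation f := (fine \o h).
Local Notation C := ((dom h)°).
Variables (c : R) (q p' p : 'rV[R]_n).
Hypothesis pmax :
  is_argmax (simplex R n) (fun x => c * dot x q - bregman h x p') p.

(** As a function of [x], [bregman h x p'] is [f x - dot (grad h p') x] up to a constant, so the
    step minimises a linear perturbation of [f]. *)
Lemma mirror_step_min y : simplex R n y ->
  f p - dot (c *: q + grad h p') p <= f y - dot (c *: q + grad h p') y.
Proof.
move=> /pmax.2; rewrite /bregman !dotBr !dotDl !dotZl ![dot q _]dotC /=.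
by lra.
Qed.

Lemma mirror_step_interior : C p.
Proof.
have [[[proper_h convex_h] C0 diff_h _ steep_h] domS [a [ra Sa]]] := mirror_h.
apply: (@argmin_interior _ _ _ proper_h convex_h diff_h steep_h (simplex R n)
  (c *: q + grad h p') _ a) => //.
- by move=> *; exact: simplex_convex.
- exact: rint_interior.
- exact: pmax.1.
- exact: mirror_step_min.
Qed.

(** First-order optimality of [p] in the direction [y - p], available because [p] is interior and
    [f] is differentiable there; in the three divergences all values of [f] cancel and only gradient
    terms remain. *)
Lemma three_point y : simplex R n y ->
  c * (dot y q - dot p q) <= bregman h y p' - bregman h p p' - bregman h y p.
Proof.
move=> Sy; have [[_ _ diff_h _ _] _ _] := mirror_h.
suff : dot (c *: q + grad h p') (y - p) <= dot (grad h p) (y - p).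
  by rewrite /bregman !dotBr !dotDl !dotZl ![dot q _]dotC; lra.
apply: dot_grad_ge; first exact/diff_h/mirror_step_interior.
move=> t /andP[t0 t1]; rewrite -dotZr.
have /mirror_step_min : simplex R n (p + t *: (y - p)).
  by apply: simplex_convex; rewrite ?(ltW t0) ?(ltW t1) //; exact: pmax.1.
by rewrite dotDr; lra.
Qed.

End MirrorDescent.


(** * Monotonicity of the shifted iterates *)

Section Iteration.
Variables (R : realType) (S A : finType) (M : mdp R S A).
Variables (h : 'rV[R]_#|A| -> \bar R) (eta : R).
Variables (pi : nat -> policy R S A) (V : nat -> S -> R).
Hypotheses (mirror_h : mirror_map h) (eta0 : 0 < eta).
Hypothesis run : td_pmd M h (fun=> eta) pi V.
Local Notation gamma := (discount M).
Local Notation kappa := (kappa0 M (pi 0%N) (V 0%N)).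
Local Notation C := ((dom h)°).

Lemma iterate_interior k s : C (pi k s).
Proof.
have [start step _] := run; have [[[proper_h convex_h] C0 _ _ _] _ _] := mirror_h.
case: k => [|k]; first exact: rint_interior.
exact: (mirror_step_interior mirror_h (step k s)).
Qed.

Lemma iterate_bregman_ge0 k s (mu : policy R S A) : 0 <= bregman h (mu s) (pi k s).
Proof.
have [[[proper_h convex_h] _ diff_h _ _] domS _] := mirror_h.
apply: bregman_ge0 => //; first exact: iterate_interior.
exact/domS/policy_rowP.
Qed.

Lemma bellman_three_point k s (mu : policy R S A) :
  eta * (bellman M mu (V k) s - bellman M (pi k.+1) (V k) s) <=
  bregman h (mu s) (pi k s) - bregman h (pi k.+1 s) (pi k s)
    - bregman h (mu s) (pi k.+1 s).
Proof.
have [_ step _] := run; rewrite !bellman_dot.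
exact: (three_point mirror_h (step k s) (policy_rowP mu s)).
Qed.

(** In the three-point inequality at [pi k] the first divergence vanishes and the other two enter
    with a minus sign. *)
Lemma bellman_improve k s :
  bellman M (pi k) (V k) s <= bellman M (pi k.+1) (V k) s.
Proof.
rewrite -subr_le0 -(pmulr_rle0 _ eta0).
rewrite (le_trans (bellman_three_point k s (pi k))) //.
have -> : bregman h (pi k s) (pi k s) = 0.
  by rewrite /bregman dotBr !subrr.
have := iterate_bregman_ge0 k s (pi k.+1).
have := iterate_bregman_ge0 k.+1 s (pi k).
by lra.
Qed.

(** The Bellman operator multiplies a constant shift by [gamma], so the factor [gamma ^+ k] keeps
    the recursion of [V], as [shiftedS] records. *)
Definition shifted k s : R := V k s - gamma ^+ k * kappa.

Lemma bellman_shifted k s (mu : policy R S A) :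
  bellman M mu (shifted k) s = bellman M mu (V k) s - gamma ^+ k.+1 * kappa.
Proof. by rewrite /shifted bellman_shift mulrA -exprS. Qed.

Lemma shiftedS k s : shifted k.+1 s = bellman M (pi k.+1) (shifted k) s.
Proof. by have [_ _ VS] := run; rewrite bellman_shifted -VS. Qed.

Lemma kappa_ge0 : 0 <= kappa.
Proof. by rewrite le_max lexx. Qed.

(** Induction: the hypothesis and [bellman_improve] give [shifted k <= shifted k.+1], and applying
    the monotone operator of [pi k.+1] to both sides gives the next case. *)
Lemma shifted_le_bellman k s : shifted k s <= bellman M (pi k) (shifted k) s.
Proof.
elim: k s => [|k IH] s.
  (* Shifting by [kappa] lowers the left side by [kappa] and the Bellman image only by
     [gamma * kappa]; the difference [(1 - gamma) * kappa] absorbs the initial defect. *)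
  have : V 0%N s - bellman M (pi 0%N) (V 0%N) s <= (1 - gamma) * kappa.
    apply: (le_trans (maxf_ge (fun s => V 0%N s - bellman M (pi 0%N) (V 0%N) s) s)).
    have /andP[_ g1] := discount_itv M.
    by rewrite -ler_pdivrMl ?subr_gt0 // le_max lexx orbT.
  by rewrite bellman_shifted /shifted expr0 expr1; lra.
rewrite {1}shiftedS; apply: bellman_mono => s'.
rewrite shiftedS (le_trans (IH s')) // !bellman_shifted.
by rewrite lerD2r bellman_improve.
Qed.

Lemma shifted_le_next k s : shifted k s <= shifted k.+1 s.
Proof.
rewrite shiftedS (le_trans (shifted_le_bellman k s)) // !bellman_shifted.
by rewrite lerD2r bellman_improve.
Qed.

Lemma shifted_homo s m n : (m <= n)%N -> shifted m s <= shifted n s.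
Proof.
apply: (homo_leq (f := shifted ^~ s) (r := <=%R)) => // [y x z|k].
  exact: le_trans.
exact: shifted_le_next.
Qed.

Lemma shifted_le_value k s : shifted k s <= value M (pi k) s.
Proof.
apply: bellman_le_fixpoint => s'; first exact: value_bellman.
exact: shifted_le_bellman.
Qed.

(** * Telescoping and the sublinear rate *)

Section Rate.
Variable pistar : policy R S A.
Hypothesis opt : optimal M pistar.
Local Notation gap k s := (opt_value M s - shifted k s).
Local Notation D k s := (bregman h (pistar s) (pi k s)).

Lemma gap_ge0 k s : 0 <= gap k s.
Proof.
by rewrite subr_ge0 (le_trans (shifted_le_value k s)) // value_le_opt.
Qed.

Lemma opt_bellman s : opt_value M s = bellman M pistar (opt_value M) s.
Proof.
have e : opt_value M = value M pistar by apply/funext => s'; rewrite opt.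
by rewrite e; exact: value_bellman.
Qed.

(** The shifts on the two Bellman images cancel; what is left is the three-point inequality at
    [pistar] without the nonnegative divergence of [pi k.+1] from [pi k]. *)
Lemma gap_step k s : gap k.+1 s <=
  gamma * \sum_s' policy_trans M pistar s s' * gap k s' + (D k s - D k.+1 s) / eta.
Proof.
rewrite -bellmanB -opt_bellman shiftedS !bellman_shifted.
suff : bellman M pistar (V k) s - bellman M (pi k.+1) (V k) s <=
    (D k s - D k.+1 s) / eta by lra.
rewrite ler_pdivlMr // mulrC (le_trans (bellman_three_point k s pistar)) //.
by have := iterate_bregman_ge0 k s (pi k.+1); lra.
Qed.

(** Summing [gap_step] bounds the gaps of index 1 to [n]; returning to the indices below [n] costs
    [gap 0 s - gap n s], and the divergences telescope. *)
Lemma sum_gap_step n s : \sum_(k < n) gap k s <=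
  gamma * (\sum_s' policy_trans M pistar s s' * \sum_(k < n) gap k s')
  + (gap 0 s - gap n s + (D 0 s - D n s) / eta).
Proof.
elim: n => [|n IH].
  by rewrite big_ord0 big1 => [|s' _]; [lra | rewrite big_ord0 mulr0].
rewrite big_ord_recr /=.
under [X in gamma * X]eq_bigr do rewrite big_ord_recr /= mulrDr.
rewrite [X in gamma * X]big_split /= mulrDr.
by have := gap_step n s; move: IH; lra.
Qed.

Lemma gap_rate T s : gap T s <= T.+1%:R^-1 *
  (1 / (1 - gamma) ^+ 2 + (norm_inf (V 0%N) + kappa) / (1 - gamma)
   + maxf (fun s => D 0 s) / (eta * (1 - gamma))).
Proof.
have /andP[g0 g1] := discount_itv M.
(* The three summands bound [opt_value], then [- V 0 + kappa], then the initial divergence over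
   [eta]; the maximum principle supplies the last factor [(1 - gamma)^-1]. *)
set b := (1 - gamma)^-1 + (norm_inf (V 0%N) + kappa) + maxf (fun s => D 0 s) / eta.
have -> : 1 / (1 - gamma) ^+ 2 + (norm_inf (V 0%N) + kappa) / (1 - gamma)
    + maxf (fun s => D 0 s) / (eta * (1 - gamma)) = b / (1 - gamma).
  by rewrite /b; field; rewrite !gt_eqF ?subr_gt0.
have head s' : gap 0 s' - gap T.+1 s' + (D 0 s' - D T.+1 s') / eta <= b.
  have := gap_ge0 T.+1 s'.
  have := iterate_bregman_ge0 T.+1 s' pistar.
  have : (D 0 s' - D T.+1 s') / eta <= maxf (fun s => D 0 s) / eta.
    rewrite ler_pM2r ?invr_gt0 //.
    have := maxf_ge (fun s => D 0 s) s'.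
    by have := iterate_bregman_ge0 T.+1 s' pistar; lra.
  have /andP[_] := value_itv M pistar s'; rewrite opt.
  have := maxf_ge (fun s => `|V 0%N s|) s'; rewrite -/(norm_inf _).
  have := ler_norm (- V 0%N s'); rewrite normrN.
by rewrite /b /shifted expr0; lra.
rewrite mulrC ler_pdivlMr ?ltr0n //.
(* Gaps decrease in [k], so [T.+1] copies of the last one are at most the sum of all, to which the
   maximum principle applies as a function of the state. *)
apply: (@le_trans _ _ (\sum_(k < T.+1) gap k s)).
  rewrite mulr_natr -[X in _ *+ X]card_ord -sumr_const ler_sum // => k _.
  by rewrite lerD2l lerN2 shifted_homo // -ltnS.
move: s; apply: (@discounted_max_principle _ _ (policy_trans M pistar) gamma).
- exact: discount_itv.
- exact: policy_trans_ge0.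
- exact: policy_trans_sum1.
- by move=> s; rewrite (le_trans (sum_gap_step T.+1 s)) // lerD2l.
Qed.

End Rate.

End Iteration.

Theorem theorem3p6 (R : realType) (S A : finType) (M : mdp R S A)
  (h : 'rV[R]_#|A| -> \bar R) (eta : R)
  (pi : nat -> policy R S A) (V : nat -> S -> R) (pistar : policy R S A) :
  (0 < #|S|)%N -> (0 < #|A|)%N ->
  mirror_map h ->
  0 < eta ->
  td_pmd M h (fun _ => eta) pi V ->
  deterministic pistar -> optimal M pistar ->
  let kappa := kappa0 M (pi 0%N) (V 0%N) in
  let B := 1 / (1 - discount M) ^+ 2
    + (norm_inf (V 0%N) + kappa) / (1 - discount M)
    + maxf (fun s => bregman h (pistar s) (pi 0%N s)) / (eta * (1 - discount M)) in
  forall T : nat, (0 < T)%N ->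
    norm_inf (fun s => opt_value M s - value M (pi T) s) <= T.+1%:R^-1 * B
    /\ norm_inf (fun s => opt_value M s - V T s)
         <= T.+1%:R^-1 * B + discount M ^+ T * kappa.
Proof.
move=> S0 _ mirror_h eta0 run _ opt kappa B T _.
have rate := gap_rate mirror_h eta0 run opt T.
have gap_value s :
    opt_value M s - value M (pi T) s <= opt_value M s - shifted M pi V T s.
  by rewrite lerD2l lerN2 (shifted_le_value mirror_h eta0 run).
have kappaT : 0 <= discount M ^+ T * kappa.
  rewrite mulr_ge0 ?kappa_ge0 ?exprn_ge0 //.
  by have /andP[] := discount_itv M.
split; apply: maxf_le => // s.
  rewrite ger0_norm ?subr_ge0 ?value_le_opt //.
  exact: le_trans (gap_value s) (rate s).
(* Here [opt_value M s - V T s] is the gap minus [discount M ^+ T * kappa]. It can be negative, but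
   since the gap is nonnegative never below minus that term, which is why the term appears in the
   second bound. *)
have := rate s; have := gap_ge0 mirror_h eta0 run T s.
rewrite -/kappa -/B ler_norml /shifted -/kappa; move: kappaT.
by move: (_ ^+ T * kappa) (_^-1 * B) => x y *; apply/andP; split; lra.
Qed.
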